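(* Let $X$ be a Banach space over $\mathbb{F}$ ($\mathbb{F}=\mathbb{R}$ or $\mathbb{C}$), let $\mathcal{L}$ be a subspace lattice on $X$ such that $\wedge\{L_-:L\in\mathcal{P}_{\mathcal{L}}\}=(0)$, and let $\delta:\mathrm{Alg}\mathcal{L}\to B(X)$ be a linear mapping. Then $\delta$ satisfies the WJD property if and only if $\delta$ is a generalized derivation and $\delta(I)A\in(\mathrm{Alg}\mathcal{L})'$ for every $A\in\mathrm{Alg}\mathcal{L}$. In particular, if $\delta(I)=0$, then $\delta$ satisfies the WJD property if and only if $\delta$ is a derivation.
   Context: $B(X)$ is the algebra of bounded linear operators on $X$. A subspace of $X$ means a norm-closed linear manifold. A subspace lattice on $X$ is a collection $\mathcal{L}$ of subspaces of $X$ containing $(0)$ and $X$ such that for every family $\{M_r\}$ in $\mathcal{L}$ the intersection $\wedge M_r$ and the closed linear span $\vee M_r$ belong to $\mathcal{L}$ (the closed span of an empty family is $(0)$, and the intersection of an empty family is $X$). $\mathrm{Alg}\mathcal{L}$ is the algebra of operators in $B(X)$ that leave every member of $\mathcal{L}$ invariant, and $(\mathrm{Alg}\mathcal{L})'$ is its commutant in $B(X)$. For $E\in\mathcal{L}$, $E_-=\vee\{F\in\mathcal{L}:F\nsupseteq E\}$, and $\mathcal{P}_{\mathcal{L}}=\{L\in\mathcal{L}:L_-\nsupseteq L\}$. A linear mapping $\delta:\mathrm{Alg}\mathcal{L}\to B(X)$ has the WJD (weak Jordan derivation) property if $\delta(AB+BA)=\delta(A)B+A\delta(B)+\delta(B)A+B\delta(A)$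 for all $A,B\in\mathrm{Alg}\mathcal{L}$ with $AB=0$. It is a derivation if $\delta(AB)=\delta(A)B+A\delta(B)$ for all $A,B$, and a generalized derivation if $\delta(AB)=\delta(A)B+A\delta(B)-A\delta(I)B$ for all $A,B$. *)

(* Defs.v *)
From HB Require Import structures.
From mathcomp Require Import all_boot all_order all_algebra.
From mathcomp Require Import all_classical all_reals all_analysis.
From mathcomp Require Export complex.
Set Implicit Arguments.
Unset Strict Implicit.
Unset Printing Implicit Defensive.
Import Order.TTheory GRing.Theory Num.Theory.
Import numFieldNormedType.Exports.
Local Open Scope classical_set_scope.
Local Open Scope ring_scope.

Section BoundedOperators.
Context {F : numFieldType}.
Implicit Type X : normedModType F.

(* F is also meant to be R[i]: then `|x| is a nonnegative real element of F, and
   an inequality of F with such a left-hand side forces k * `|x| to be real. *)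
Definition bounded_linear X : {pred X -> X} := fun A =>
  `[< linear A /\ exists k : F, forall x, `|A x| <= k * `|x| >].

Record bounded_op X := BoundedOp {
  bounded_op_fun :> X -> X;
  bounded_op_subproof : bounded_op_fun \in @bounded_linear X }.

HB.instance Definition _ X := [isSub for @bounded_op_fun X].
HB.instance Definition _ X := [Choice of bounded_op X by <:].

Fact bounded_linear_submod_closed X : submod_closed (@bounded_linear X).
Proof.
split=> [|a f g /asboolP[fl [k fk]] /asboolP[gl [l gL]]]; apply/asboolP.
  split=> [b x y /=|]; first by rewrite [LHS]/(0 : X) scaler0 addr0.
  by exists 0 => x; rewrite [X in `|X|]/(0 : X) normr0 mul0r.
have fgE x : (a *: f + g) x = a *: f x + g x by [].
split=> [b x y|].
  by rewrite !fgE fl gl !scalerDr !scalerA [b * a]mulrC addrACA.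
exists (`|a| * k + l) => x; rewrite fgE mulrDl (le_trans (ler_normD _ _))//.
by rewrite lerD// normrZ -mulrA ler_wpM2l.
Qed.

HB.instance Definition _ X := GRing.isSubmodClosed.Build F (X -> X)
  (@bounded_linear X) (bounded_linear_submod_closed X).
HB.instance Definition _ X :=
  [SubChoice_isSubLmodule of bounded_op X by <:].

Lemma bounded_op_linear X (A : bounded_op X) : linear A.
Proof. by case: A => A /= /asboolP[]. Qed.

HB.instance Definition _ X (A : bounded_op X) :=
  GRing.isLinear.Build F X X *:%R A (bounded_op_linear A).

Lemma bounded_op_bound X (A : bounded_op X) :
  exists2 k : F, 0 <= k & forall x, `|A x| <= k * `|x|.
Proof.
case: A => A /= /asboolP[_ [k Ak]]; exists `|k| => // x.
rewrite (le_trans (Ak x))// -[leLHS]ger0_norm ?normrM ?normr_id//.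
exact: le_trans (Ak x).
Qed.

Fact bounded_op_one_subproof X : (id : X -> X) \in @bounded_linear X.
Proof. by apply/asboolP; split=> //; exists 1 => x; rewrite mul1r. Qed.

Definition bounded_op_one X : bounded_op X :=
  BoundedOp (bounded_op_one_subproof X).

Fact bounded_op_mul_subproof X (A B : bounded_op X) :
  A \o B \in @bounded_linear X.
Proof.
apply/asboolP; split=> [b x y|/=]; first by rewrite /= !linearP.
have [[k k0 Ak] [l _ Bl]] := (bounded_op_bound A, bounded_op_bound B).
exists (k * l) => x; rewrite (le_trans (Ak _))// -mulrA.
by rewrite ler_wpM2l.
Qed.

Definition bounded_op_mul X (A B : bounded_op X) : bounded_op X :=
  BoundedOp (bounded_op_mul_subproof A B).

Fact bounded_op_mulA X : associative (@bounded_op_mul X).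
Proof. by move=> A B C; exact: val_inj. Qed.

Fact bounded_op_mul1 X : left_id (bounded_op_one X) (@bounded_op_mul X).
Proof. by move=> A; exact: val_inj. Qed.

Fact bounded_op_mulr1 X : right_id (bounded_op_one X) (@bounded_op_mul X).
Proof. by move=> A; exact: val_inj. Qed.

Fact bounded_op_mulDl X : left_distributive (@bounded_op_mul X) +%R.
Proof. by move=> A B C; exact: val_inj. Qed.

Fact bounded_op_mulDr X : right_distributive (@bounded_op_mul X) +%R.
Proof.
by move=> A B C; apply: val_inj; apply/funext => x; exact: (linearD A).
Qed.

(* X may be the zero space, so B(X) is only a possibly zero ring. *)
HB.instance Definition _ X := GRing.Zmodule_isPzRing.Build (bounded_op X)
  (@bounded_op_mulA X) (@bounded_op_mul1 X) (@bounded_op_mulr1 X)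
  (@bounded_op_mulDl X) (@bounded_op_mulDr X).

End BoundedOperators.

Section SubspaceLattices.
Context {F : numFieldType}.
Implicit Type X : normedModType F.

Definition is_subspace X (M : set X) := closed M /\ submod_closed [in M].

Definition closed_span X (S : set X) : set X :=
  closure (smallest (fun M : set X => submod_closed [in M]) S).

Definition sup_subspace X (G : set (set X)) : set X :=
  closed_span (\bigcup_(M in G) M).

Definition inf_subspace X (G : set (set X)) : set X := \bigcap_(M in G) M.

Record subspace_lattice X := SubspaceLattice {
  lattice_set :> set X -> Prop;
  lattice_subspace : forall M, lattice_set M -> is_subspace M;
  lattice_bot : lattice_set [set 0];
  lattice_top : lattice_set setT;
  lattice_inf : forall G, G `<=` lattice_set -> lattice_set (inf_subspace G);
  lattice_sup : forall G, G `<=` lattice_set -> lattice_set (sup_subspace G) }.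

(* E_- *)
Definition lattice_minus X (L : subspace_lattice X) (E : set X) : set X :=
  sup_subspace [set G | L G /\ ~ (E `<=` G)].

(* The set written $\mathcal{P}_{\mathcal{L}}$ *)
Definition lattice_P X (L : subspace_lattice X) : set (set X) :=
  [set E | L E /\ ~ (E `<=` lattice_minus L E)].

Definition invariant_pred X (L : subspace_lattice X) : {pred bounded_op X} :=
  fun A => `[< forall M, L M -> A @` M `<=` M >].

Record Alg X (L : subspace_lattice X) := AlgOp {
  alg_op :> bounded_op X;
  alg_op_subproof : alg_op \in invariant_pred L }.

HB.instance Definition _ X (L : subspace_lattice X) := [isSub for @alg_op X L].
HB.instance Definition _ X (L : subspace_lattice X) := [Choice of Alg L by <:].

Fact invariant_submod_closed X (L : subspace_lattice X) :
  submod_closed (invariant_pred L).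
Proof.
split=> [|a A B /asboolP AL /asboolP BL]; apply/asboolP => M LM _ [x Mx <-].
  by have [_ [/set_mem M0 _]] := lattice_subspace LM.
have [_ [_ MD]] := lattice_subspace LM.
apply/set_mem/(MD a (A x) (B x)); apply/mem_set.
- by apply: (AL _ LM); exists x.
- by apply: (BL _ LM); exists x.
Qed.

Fact invariant_subring_closed X (L : subspace_lattice X) :
  subring_closed (invariant_pred L).
Proof.
have [s0 sD] := invariant_submod_closed L.
split=> [|A B AL BL|A B /asboolP AL /asboolP BL].
- by apply/asboolP => M LM _ [x Mx <-].
- by rewrite addrC -scaleN1r; exact: sD.
apply/asboolP => M LM _ [x Mx <-]; apply: (AL _ LM); exists (B x) => //.
by apply: (BL _ LM); exists x.
Qed.

HB.instance Definition _ X (L : subspace_lattice X) :=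
  GRing.isSubmodClosed.Build F (bounded_op X)
    (invariant_pred L) (invariant_submod_closed L).
HB.instance Definition _ X (L : subspace_lattice X) :=
  GRing.isSubringClosed.Build (bounded_op X)
    (invariant_pred L) (invariant_subring_closed L).
HB.instance Definition _ X (L : subspace_lattice X) :=
  [SubChoice_isSubLmodule of Alg L by <:].
HB.instance Definition _ X (L : subspace_lattice X) :=
  GRing.SubZmodule_isSubPzRing.Build (bounded_op X) (invariant_pred L) (Alg L)
    (GRing.subringClosedP _).

Definition commutant X (L : subspace_lattice X) : set (bounded_op X) :=
  [set T | forall A : Alg L, T * (A : bounded_op X) = (A : bounded_op X) * T].

Section Derivations.
Context {X : normedModType F} {L : subspace_lattice X}.
Variable delta : Alg L -> bounded_op X.

Definition WJD := forall A B : Alg L, A * B = 0 ->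
  delta (A * B + B * A)
  = delta A * B + (A : bounded_op X) * delta B
    + delta B * A + (B : bounded_op X) * delta A.

Definition derivation := forall A B : Alg L,
  delta (A * B) = delta A * B + (A : bounded_op X) * delta B.

Definition generalized_derivation := forall A B : Alg L,
  delta (A * B) = delta A * B + (A : bounded_op X) * delta B
                  - (A : bounded_op X) * delta 1 * B.

End Derivations.

End SubspaceLattices.

(* Main.v *)
(** For E in P_L, e in E and a bounded functional h vanishing on E_-, the
    rank-one operator e (x) h : x |-> h(x) e lies in Alg L, and it is a linear
    combination of rank-one idempotents of the same form. By the Hahn-Banach
    theorem and the hypothesis on the meet of the E_-, an operator T with
    S T = 0 for all such S is zero.

    If delta is WJD and P is an idempotent, the pairs of Peirce corners with
    product zero show that delta(I) commutes with P, that delta(I)(PA - AP) = 0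
    and that D = delta - delta(I) _ satisfies D(PA + AP) = D(P)A + P D(A) +
    D(A)P + A D(P). These identities pass to rank-one operators by linearity;
    the first two then hold on all of Alg L since the rank-one operators form
    an ideal. Applied to N o N = 0 for a square-zero corner N of A with respect
    to a rank-one idempotent P, the last one gives D(N)N + N D(N) = 0, which
    excludes the antiderivation part and yields D(PA) = D(P)A + P D(A). Finally
    S (D(AB) - D(A)B - A D(B)) = 0 for all rank-one S by expanding D(SAB). *)

Require Import Defs.
From HB Require Import structures.
From Stdlib Require Ncring Ncring_tac.
From mathcomp Require Import all_boot all_order all_algebra.
From mathcomp Require Import all_classical all_reals all_analysis.
From mathcomp Require Import complex.
Set Implicit Arguments.
Unset Strict Implicit.
Unset Printing Implicit Defensive.
Import Order.TTheory GRing.Theory Num.Theory.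
Import numFieldNormedType.Exports.
Local Open Scope classical_set_scope.
Local Open Scope ring_scope.
Local Open Scope complex_scope.

(** * Weak Jordan derivations of rings and idempotents *)

(** These instances let [ncring] decide noncommutative ring identities in any [pzRingType]. *)
#[local] Instance pzRing_ops (B : pzRingType) :
  @Ncring.Ring_ops B 0 1 +%R *%R (fun x y => x - y) -%R eq := {}.

#[local] Instance pzRing_ring (B : pzRingType) :
  @Ncring.Ring B 0 1 +%R *%R (fun x y => x - y) -%R eq (pzRing_ops B).
Proof.
split; try by [].
- typeclasses eauto.
- by move=> x _ <- y _ <-.
- by move=> x _ <- y _ <-.
- by move=> x _ <- y _ <-.
- by move=> x _ <-.
- exact: add0r.
- exact: addrC.
- exact: addrA.
- exact: mul1r.
- exact: mulr1.
- exact: mulrA.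
- exact: mulrDl.
- by move=> *; exact: mulrDr.
- exact: addrN.
Qed.

Local Ltac ncring := Ncring_tac.non_commutative_ring.

Section WeakJordan.
(** The model is A = Alg L, B = B(X), with [i] the inclusion. *)
Context {A B : pzRingType} (i : {rmorphism A -> B}) (d : {additive A -> B}).
Hypothesis add_self_eq0 : forall b : B, b + b = 0 -> b = 0.
Hypothesis dW : forall a b : A, a * b = 0 ->
  d (a * b + b * a) = d a * i b + i a * d b + d b * i a + i b * d a.

Let mulD := (mulrDl, mulrDr, mulNr, mulrN, mulr1, mul1r, mulr0, mul0r, mulrA).

(** WJD for the pair p, 1 - p gives [H]. Compressing [H] by p on both sides yields p d(p) p = p d(1)
    p; one-sided products with p then give p d(1) = p d(1) p = d(1) p. *)
Lemma wjd_unit_idempotent (p : A) : p * p = p -> d 1 * i p = i p * d 1.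
Proof.
move=> pp; have /(congr1 i) := pp; rewrite (rmorphM i) => ipp.
have ippl b : b * i p * i p = b * i p by rewrite -mulrA ipp.
have p0 : p * (1 - p) = 0 by rewrite mulrBr mulr1 pp subrr.
have p0' : (1 - p) * p = 0 by rewrite mulrBl mul1r pp subrr.
have /esym := dW p0.
rewrite p0 p0' addr0 !raddf0 !(rmorphB i, raddfB d) (rmorph1 i) => H.
have pdp : i p * d p * i p = i p * d 1 * i p.
  apply/eqP; rewrite -subr_eq0; apply/eqP/add_self_eq0.
  have /(congr1 (fun z => i p * z * i p)) := H.
  rewrite !(mulD, ipp, ippl) => h; rewrite -[RHS]oppr0 -h.
  ncring.
have e1 : i p * d 1 = i p * d 1 * i p.
  apply/eqP; rewrite -subr_eq0 -[X in _ == X]oppr0; apply/eqP.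
  have /(congr1 (fun z => i p * z)) := H.
  rewrite !(mulD, ipp, ippl) pdp oppr0 => h; rewrite -[RHS]h.
  ncring.
have e2 : d 1 * i p = i p * d 1 * i p.
  apply/eqP; rewrite -subr_eq0; apply/eqP.
  have /(congr1 (fun z => z * i p)) := H.
  rewrite !(mulD, ipp, ippl) pdp => h; rewrite -[RHS]h.
  ncring.
by rewrite e1.
Qed.

(** A corner n = q a (1 - q) satisfies n q = 0 and (1 - q) n = 0. Adding the two WJD identities
    leaves d(1) n + n d(1) = 0, so d(1) n = 0 by centrality. The commutator is the difference of the
    corners for p and 1 - p. *)
Lemma wjd_unit_commutator (p a : A) : (forall b, d 1 * i b = i b * d 1) ->
  p * p = p -> d 1 * i (p * a - a * p) = 0.
Proof.
move=> d1C.
have corner q : q * q = q -> d 1 * i (q * a * (1 - q)) = 0.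
  move=> qq; set n := q * a * (1 - q).
  have nq : n * q = 0 by rewrite /n -mulrA mulrBl mul1r qq subrr mulr0.
  have qn : q * n = n by rewrite /n !mulrA qq.
  have qn' : (1 - q) * n = 0 by rewrite mulrBl mul1r qn subrr.
  have nq' : n * (1 - q) = n by rewrite mulrBr mulr1 nq subr0.
  have := dW qn'; have := dW nq.
  rewrite nq qn qn' nq' !add0r !(rmorphB i, raddfB d) (rmorph1 i) => h1 h2.
  apply: add_self_eq0; rewrite {2}d1C.
  have := congr1 (+%R^~ (- (d n + d n))) (congr2 +%R h1 h2).
  rewrite subrr => h; rewrite [RHS]h; ncring.
move=> pp.
have := corner _ pp; have := corner (1 - p).
have pp' : (1 - p) * (1 - p) = 1 - p.
  by rewrite mulrBl mul1r mulrBr mulr1 pp subrr subr0.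
move=> /(_ pp') h1 h2.
suff -> : p * a - a * p = p * a * (1 - p) - (1 - p) * a * (1 - (1 - p)).
  by rewrite raddfB mulrBr h1 h2 subrr.
ncring.
Qed.

Hypothesis d1 : d 1 = 0.

Lemma wjd_idempotent (p : A) : p * p = p -> d p = d p * i p + i p * d p.
Proof.
move=> pp; have p0 : p * (1 - p) = 0 by rewrite mulrBr mulr1 pp subrr.
have p0' : (1 - p) * p = 0 by rewrite mulrBl mul1r pp subrr.
have /esym := dW p0.
rewrite p0 p0' addr0 !raddf0 !(rmorphB i, raddfB d) (rmorph1 i) d1 => H.
apply/eqP; rewrite -subr_eq0; apply/eqP/add_self_eq0; rewrite -[RHS]H.
ncring.
Qed.

(** The identity is additive in a and is WJD itself when p a = 0 or a p = 0. The remaining corner p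
    a p is treated through its zero product with 1 - p. *)
Lemma wjd_jordan_idempotent (p a : A) : p * p = p ->
  d (p * a + a * p) = d p * i a + i p * d a + d a * i p + i a * d p.
Proof.
move=> pp; have ppl b : b * p * p = b * p by rewrite -mulrA pp.
pose J b := d (p * b + b * p) = d p * i b + i p * d b + d b * i p + i b * d p.
have JD b c : J b -> J c -> J (b + c).
  rewrite /J => Jb Jc.
  have -> : p * (b + c) + (b + c) * p = (p * b + b * p) + (p * c + c * p).
    ncring.
  by rewrite raddfD Jb Jc !(rmorphD i, raddfD); ncring.
have Jl b : p * b = 0 -> J b by move=> /dW.
have Jr b : b * p = 0 -> J b.
  by move=> /dW; rewrite /J addrC => ->; ncring.
rewrite -/(J a); have -> : a = p * a * p + (p * a * (1 - p) + (1 - p) * a).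
  ncring.
apply: (JD); last apply: (JD); last 2 first.
- by apply: Jr; rewrite !(mulD, ppl) subrr.
- by apply: Jl; rewrite !(mulD, pp) subrr.
set k := p * a * p.
have pk : p * k = k by rewrite /k !mulrA pp.
have kp : k * p = k by rewrite /k ppl.
have kp' : k * (1 - p) = 0 by rewrite mulrBr mulr1 kp subrr.
have := dW kp'; rewrite kp' mulrBl mul1r pk subrr addr0 !raddf0.
rewrite !(rmorphB i, raddfB d) (rmorph1 i).
rewrite /J pk kp raddfD d1 => /esym h.
apply/eqP; rewrite -subr_eq0 -[X in _ == X]h; apply/eqP.
ncring.
Qed.

(* In the Peirce decomposition of [a] with respect to [p], the Jordan identity
   does not control the entries [(1 - p) d(n) p] and [p d(m) (1 - p)] of the
   off-diagonal corners [n] and [m]; the last two hypotheses are what makes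
   them vanish when [p] has rank one. *)
Lemma wjd_derivation_idempotent (p a : A) (k := p * a * p)
    (n := p * a * (1 - p)) (m := (1 - p) * a * p) : p * p = p ->
  d k = d p * i k + i p * d k ->
  (1 - i p) * d n * i p = 0 -> i p * d m * (1 - i p) = 0 ->
  d (p * a) = d p * i a + i p * d a.
Proof.
move=> pp dk hn hm; have dp := wjd_idempotent pp.
have ppl b : b * p * p = b * p by rewrite -mulrA pp.
have /(congr1 i) := pp; rewrite (rmorphM i) => ipp.
have ippl b : b * i p * i p = b * i p by rewrite -mulrA ipp.
pose q := (1 - p) * a * (1 - p).
pose J b := d (p * b) = d p * i b + i p * d b.
have JD b c : J b -> J c -> J (b + c).
  by rewrite /J => Jb Jc; rewrite mulrDr (rmorphD i) !raddfD Jb Jc; ncring.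
rewrite -/(J a); have -> : a = k + n + (m + q) by rewrite /k /n /m /q; ncring.
have p0 : p * (1 - p) = 0 by rewrite mulrBr mulr1 pp subrr.
have p0' : (1 - p) * p = 0 by rewrite mulrBl mul1r pp subrr.
have pn : p * n = n by rewrite /n !mulrA pp.
have np : n * p = 0 by rewrite /n -!mulrA p0' !mulr0.
have pm : p * m = 0 by rewrite /m !mulrA p0 !mul0r.
have mp : m * p = m by rewrite /m ppl.
have pq : p * q = 0 by rewrite /q !mulrA p0 !mul0r.
have qp : q * p = 0 by rewrite /q -!mulrA p0' !mulr0.
have imul b c e : b * c = e -> i b * i c = i e by move=> <-; rewrite rmorphM.
have imul' b c e : b * c = e -> forall x, x * i b * i c = x * i e.
  by move=> <- x; rewrite rmorphM mulrA.
have sim b c e (h : b * c = e) := (imul _ _ _ h, imul' _ _ _ h).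
have simp := (sim _ _ _ pn, sim _ _ _ np, sim _ _ _ pm, sim _ _ _ mp,
  sim _ _ _ pq, sim _ _ _ qp, ipp, ippl, rmorph0 i, mulD, add0r, addr0, oppr0).
(* The claim is checked on each corner. For n, m and q the Jordan identity leaves two terms that
   must cancel; [dp] and the hypotheses on n and m put both in compressed form, and a compression of
   the Jordan identity by p cancels them. *)
apply: (JD); apply: (JD).
- by rewrite /J /k !mulrA pp.
- have := wjd_jordan_idempotent n pp; rewrite pn np addr0 /J pn => dn.
  have e1 : i n * d p = i n * d p * i p.
    by have /(congr1 (fun z => i n * z)) := dp; rewrite !simp.
  have e2 : d n * i p = i p * d n * i p.
    by apply/eqP; rewrite -subr_eq0; apply/eqP; rewrite -hn !simp.
  have e3 : i p * d n * i p + i n * d p * i p = 0.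
    have /(congr1 (fun z => i p * z * i p - i p * d n * i p)) := dn.
    rewrite subrr !simp => h; rewrite [RHS]h.
    ncring.
  rewrite {1}dn e1 e2; apply/eqP; rewrite -subr_eq0 -[X in _ == X]e3; apply/eqP.
  ncring.
- have := wjd_jordan_idempotent m pp; rewrite pm mp add0r /J pm raddf0 => dm.
  have e1 : d p * i m = i p * d p * i m.
    by have /(congr1 (fun z => z * i m)) := dp; rewrite !simp.
  have e2 : i p * d m = i p * d m * i p.
    by apply/eqP; rewrite -subr_eq0; apply/eqP; rewrite -hm !simp.
  have e3 : i p * d m * i p + i p * d p * i m = 0.
    have /(congr1 (fun z => i p * z * i p - i p * d m * i p)) := dm.
    rewrite subrr !simp => h; rewrite [RHS]h.
    ncring.
  by rewrite e1 e2 addrC e3.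
- have := wjd_jordan_idempotent q pp; rewrite pq qp add0r /J pq raddf0 => dq.
  have e1 : d p * i q = i p * d p * i q.
    by have /(congr1 (fun z => z * i q)) := dp; rewrite !simp.
  have e3 : i p * d q * i p = 0.
    apply: add_self_eq0.
    have /(congr1 (fun z => z * i p)) := dq; rewrite !simp => h.
    have /(congr1 (fun z => i p * z)) := h; rewrite !simp => h'.
    rewrite [RHS]h'.
    ncring.
  have /(congr1 (fun z => i p * z)) := dq; rewrite !simp e3 => h.
  rewrite [LHS]h e1; ncring.
Qed.

End WeakJordan.

(** * Hahn-Banach separation over R and R[i] *)

Section HahnBanach.
Context {R : realType} {F : numFieldType} (i : {rmorphism R -> F}).
Context {V : lmodType F} (p : V -> R).
Hypothesis pD : forall v w, p (v + w) <= p v + p w.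
Hypothesis pZ : forall a v, 0 <= a -> p (i a *: v) = a * p v.

(* Such a linear relation is automatically single-valued: (0, t) in G forces
   n t <= p 0 = 0 for all integers n. *)
Definition dominated_graph (G : set (V * R)) := [/\ G (0, 0),
  forall a v t w s, G (v, t) -> G (w, s) -> G (i a *: v + w, a * t + s) &
  forall v t, G (v, t) -> t <= p v].

(** One-dimensional extension step: subadditivity puts every t - p(v - x) below every p(w + x) - s,
    and the supremum c of the former is taken as the value at x. *)
Lemma dominated_graph_extend (G : set (V * R)) (x : V) : dominated_graph G ->
  exists H, [/\ dominated_graph H, G `<=` H & exists c, H (x, c)].
Proof.
move=> [G0 GD Gp].
pose S := [set y | exists v t, G (v, t) /\ y = t - p (v - x)].
have Sub w s : G (w, s) -> ubound S (p (w + x) - s).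
  move=> Gws _ [v [t [Gvt ->]]]; rewrite lerBlDr addrAC lerBrDr.
  have /Gp := GD 1 _ _ _ _ Gvt Gws; rewrite rmorph1 scale1r mul1r.
  move=> /le_trans; apply; rewrite (le_trans _ (pD _ _))//.
  by rewrite addrACA subrr addr0 addrC.
pose c := sup S.
have S0 : S !=set0 by exists (0 - p (0 - x)), 0, 0.
have cu w s : G (w, s) -> c + s <= p (w + x).
  by move=> Gws; rewrite -lerBrDr; apply: ge_sup => //; exact: Sub.
have cl v t : G (v, t) -> t - c <= p (v - x).
  move=> Gvt; rewrite lerBlDr addrC -lerBlDr; apply: ub_le_sup.
    by exists (p (0 + x) - 0); exact: Sub.
  by exists v, t.
have iK a : a != 0 -> i a * i a^-1 = 1.
  by move=> a0; rewrite -rmorphM divff// rmorph1.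
exists [set y | exists v t a, G (v, t) /\ y = (v + i a *: x, t + a * c)].
split; last 2 first.
- move=> [v t] Gvt; exists v, t, 0; split=> //.
  by rewrite rmorph0 scale0r mul0r !addr0.
- by exists c, 0, 0, 1; split=> //; rewrite rmorph1 scale1r mul1r !add0r.
split.
- by exists 0, 0, 0; rewrite rmorph0 scale0r mul0r !addr0.
- move=> a _ _ _ _ [v [t [b [Gvt [-> ->]]]]] [w [s [e [Gws [-> ->]]]]].
  exists (i a *: v + w), (a * t + s), (a * b + e); split; first exact: GD.
  rewrite rmorphD rmorphM scalerDl !scalerDr mulrDl !mulrDr scalerA mulrA.
  by rewrite addrACA [X in (_, X) = _]addrACA.
- move=> _ _ [v [t [a [Gvt [-> ->]]]]].
  have Gs b : G (i b *: v, b * t).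
    by have := GD b _ _ _ _ Gvt G0; rewrite !addr0.
  have [->|a0] := eqVneq a 0.
    by rewrite rmorph0 scale0r mul0r !addr0; exact: Gp.
  (* Positive homogeneity reduces the bound to a = 1, which is [cu], or to a = -1, which is [cl]. *)
  have [ap|an] := ltP 0 a.
    have -> : v + i a *: x = i a *: (i a^-1 *: v + x).
      by rewrite scalerDr scalerA iK// scale1r.
    have -> : t + a * c = a * (c + a^-1 * t) by rewrite mulrDr mulVKf// addrC.
    by rewrite pZ ?(ltW ap)// ler_wpM2l ?(ltW ap)//; exact: cu.
  have an' : 0 <= - a by rewrite oppr_ge0.
  have Na0 : - a != 0 by rewrite oppr_eq0.
  have -> : v + i a *: x = i (- a) *: (i (- a)^-1 *: v - x).
    by rewrite scalerBr scalerA iK// scale1r rmorphN scaleNr opprK.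
  have -> : t + a * c = - a * ((- a)^-1 * t - c).
    by rewrite mulrBr mulVKf// mulNr opprK.
  by rewrite pZ// ler_wpM2l//; exact: cl.
Qed.

Lemma hahn_banach (G0 : set (V * R)) : dominated_graph G0 ->
  exists u : V -> R, [/\ forall a v w, u (i a *: v + w) = a * u v + u w,
    forall v, u v <= p v & forall v t, G0 (v, t) -> u v = t].
Proof.
move=> dG0.
(* Asking that G0 [|] G be dominated, rather than G, makes the empty union of the empty chain
   admissible. *)
have [|G [dG Gmax]] := @Zorn_bigcup _ [set G | dominated_graph (G0 `|` G)].
  move=> C CP Ctot; set U := \bigcup_(X in C) X.
  have both x y : (G0 `|` U) x -> (G0 `|` U) y -> exists H : set (V * R),
      [/\ dominated_graph H, H `<=` G0 `|` U, H x & H y].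
    have inC Z : C Z -> dominated_graph (G0 `|` Z) /\ G0 `|` Z `<=` G0 `|` U.
      by move=> CZ; split; [exact: CP|apply: setUS; exact: bigcup_sup].
    move=> [x0|[Y CY Yx]] [y0|[Z CZ Zy]].
    - by exists G0; split.
    - by have [? ?] := inC _ CZ; exists (G0 `|` Z); split=> //; [left|right].
    - by have [? ?] := inC _ CY; exists (G0 `|` Y); split=> //; [right|left].
    - have [YZ|ZY] := Ctot _ _ CY CZ.
        have [? ?] := inC _ CZ; exists (G0 `|` Z).
        by split=> //; right => //; exact: YZ.
      have [? ?] := inC _ CY; exists (G0 `|` Y).
      by split=> //; right => //; exact: ZY.
  split.
  - by left; case: dG0.
  - move=> a v t w s Uv Uw; have [H [[_ HD _] HU Hv Hw]] := both _ _ Uv Uw.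
    by apply: HU; exact: HD.
  - move=> v t Uv; have [H [[_ _ Hp] _ Hv _]] := both _ _ Uv Uv.
    exact: Hp Hv.
set H := G0 `|` G in dG.
(* A point without a value would give a dominated extension strictly larger than the maximal G. *)
have Htot x : exists t, H (x, t).
  have [K [dK HK [c Kxc]]] := dominated_graph_extend x dG.
  exists c; apply/not_notP => nH; apply: (Gmax K).
    split=> [z Gz|KG]; first by apply: HK; right.
    by apply: nH; right; exact: KG.
  have GK : G0 `|` K = K by apply/setUidPr => z G0z; apply: HK; left.
  by rewrite /= GK.
have [H0 HD Hp] := dG.
have Hle x t s : H (x, t) -> H (x, s) -> t <= s.
  move=> Ht Hs; have := HD (-1) _ _ _ _ Hs Ht.
  rewrite rmorphN rmorph1 scaleN1r mulN1r addNr => /Hp.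
  have -> : p 0 = 0 by rewrite -(scale0r 0) -(rmorph0 i) pZ// mul0r.
  by rewrite addrC subr_le0.
have [u Hu] := choice Htot.
have uE x t : H (x, t) -> u x = t.
  move=> Ht; apply/eqP; rewrite eq_le.
  by rewrite (Hle _ _ _ (Hu x) Ht) (Hle _ _ _ Ht (Hu x)).
exists u; split=> [a v w|v|v t G0v].
- by apply: uE; exact: HD (Hu v) (Hu w).
- exact: Hp (Hu v).
- by apply: uE; left.
Qed.

End HahnBanach.

Lemma is_subspaceP (F : numFieldType) (X : normedModType F) (M : set X) :
  is_subspace M -> M 0 /\ forall a v w, M v -> M w -> M (a *: v + w).
Proof.
move=> [_ [M0 MD]]; split; first exact: set_mem.
by move=> a v w Mv Mw; apply/set_mem/MD; exact/mem_set.
Qed.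

(* R and R[i] are treated together: [i] embeds R into F, and [i_surj] makes the
   F-valued norm a real one. *)
Section RealSeparation.
Context {R : realType} {F : numFieldType} (i : {rmorphism R -> F}).
Hypothesis i_ge0 : forall a, (0 <= i a) = (0 <= a).
Hypothesis i_surj : forall e, 0 <= e -> exists a, i a = e.

(** Since M is closed, x has distance at least some r > 0 from M. This is exactly what makes m + t x
    |-> t on M + R x dominated by the norm divided by r. Domination at v and at -v bounds the
    extension. *)
Lemma real_separation (X : normedModType F) (M : set X) (x : X) :
  is_subspace M -> ~ M x ->
  exists u : X -> R, [/\ forall a v w, u (i a *: v + w) = a * u v + u w,
    exists k, forall v, `|i (u v)| <= k * `|v|,
    forall v, M v -> u v = 0 & u x = 1].
Proof.
move=> Msub Mx; have [Mcl _] := Msub; have [M0 MD] := is_subspaceP Msub.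
have [r r0 rM] : exists2 r, 0 < r & forall m, M m -> i r <= `|x - m|.
  have : nbhs x (~` M).
    by apply: open_nbhs_nbhs; split=> //; exact: closed_openC.
  move=> /nbhs_ballP[e /= e0]; rewrite -ball_normE => eM.
  have [r re] := i_surj (ltW e0); exists r.
    rewrite lt_neqAle -i_ge0 re (ltW e0) andbT.
    by apply: contraTneq e0 => r0; rewrite -re -r0 rmorph0 ltxx.
  move=> m Mm; rewrite re real_leNgt ?normr_real ?gtr0_real//.
  by apply/negP => /eM /=; exact.
have i_le a b : (i a <= i b) = (a <= b).
  by rewrite -subr_ge0 -rmorphB i_ge0 subr_ge0.
have i_inj a b : i a = i b -> a = b.
  by move=> ab; apply/eqP; rewrite eq_le -!i_le ab lexx.
have [N NE] := choice (fun v : X => i_surj (normr_ge0 v)).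
pose p v := N v / r.
have pD v w : p (v + w) <= p v + p w.
  rewrite /p -mulrDl ler_wpM2r ?invr_ge0 ?(ltW r0)//.
  by rewrite -i_le rmorphD !NE ler_normD.
have pZ a v : 0 <= a -> p (i a *: v) = a * p v.
  move=> a0; rewrite /p mulrA; congr (_ / r); apply: i_inj.
  by rewrite rmorphM !NE normrZ ger0_norm ?i_ge0.
pose G0 := [set y : X * R | exists m t, M m /\ y = (m + i t *: x, t)].
have [|u [uL up uG]] := hahn_banach pD pZ (G0 := G0).
  split.
  - by exists 0, 0; rewrite rmorph0 scale0r addr0.
  - move=> a _ _ _ _ [m [t [Mm [-> ->]]]] [n [s [Mn [-> ->]]]].
    exists (i a *: m + n), (a * t + s); split; first exact: MD.
    by rewrite rmorphD rmorphM scalerDl scalerDr scalerA addrACA.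
  - move=> _ _ [m [t [Mm [-> ->]]]]; rewrite /p ler_pdivlMr//.
    have [t0|t0] := leP t 0.
      rewrite (@le_trans _ _ 0)// ?mulr_le0_ge0 ?(ltW r0)//.
      by rewrite -i_ge0 NE.
    have -> : m + i t *: x = i t *: (x - i (- t^-1) *: m).
      rewrite scalerBr scalerA -rmorphM mulrN divff ?gt_eqF//.
      by rewrite rmorphN rmorph1 scaleN1r opprK addrC.
    rewrite -i_le rmorphM NE normrZ ger0_norm ?i_ge0 ?(ltW t0)//.
    rewrite ler_wpM2l ?i_ge0 ?(ltW t0)// rM//.
    by rewrite -[_ *: _]addr0; exact: MD.
have u0 : u 0 = 0.
  have := uL 1 0 0; rewrite rmorph1 scale1r addr0 mul1r => h.
  by apply: (addrI (u 0)); rewrite addr0.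
have uN v : u (- v) = - u v.
  by have := uL (-1) v 0; rewrite rmorphN rmorph1 scaleN1r mulN1r u0 !addr0.
exists u; split=> //.
- exists (i r^-1) => v.
  have le w : i (u w) <= i r^-1 * `|w|.
    by rewrite -NE -rmorphM i_le mulrC.
  have [uv0|uv0] := leP 0 (u v); first by rewrite ger0_norm ?i_ge0.
  have -> : `|i (u v)| = i (u (- v)).
    by rewrite uN rmorphN -normrN ger0_norm// -rmorphN i_ge0 oppr_ge0 ltW.
  by rewrite -(normrN v) le.
- move=> v Mv; apply: uG; exists v, 0; split=> //.
  by rewrite rmorph0 scale0r addr0.
- by apply: uG; exists 0, 1; split=> //; rewrite rmorph1 scale1r add0r.
Qed.

End RealSeparation.

Definition bounded_annihilator (F : numFieldType) (X : normedModType F)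
    (M : set X) (h : X -> F) :=
  [/\ forall a v w, h (a *: v + w) = a * h v + h w,
      exists k, forall v, `|h v| <= k * `|v| & forall v, M v -> h v = 0].

Lemma separation (R : realType) (F : numFieldType)
    (F_real_or_complex : F = R :> numFieldType \/ F = R[i] :> numFieldType)
    (X : normedModType F) (M : set X) (x : X) : is_subspace M -> ~ M x ->
  exists2 h, bounded_annihilator M h & h x != 0.
Proof.
case: F_real_or_complex => FE; subst F => Msub Mx.
  have [|a|u [uL ub uM ux]] := @real_separation R R idfun _ _ X M x Msub Mx.
  - by [].
  - by move=> e0; exists a.
  by exists u; [split|rewrite ux oner_eq0].
have [a|e|u [uL ub uM ux]] :=
  @real_separation R R[i] (real_complex R) _ _ X M x Msub Mx.
- exact: ler0c.
- by case: e => a b; rewrite lecE /= => /andP[/eqP-> _]; exists a.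
(* The complexified functional also evaluates u at 'i *: v, so vanishing on M requires stability
   under 'i. *)
have Mi v : M v -> M ('i *: v).
  by have [M0 MD] := is_subspaceP Msub; rewrite -[_ *: _]addr0 => /MD; exact.
(* Complexification of a real functional: h is C-linear with real part u. *)
pose h v : R[i] := (u v)%:C - 'i * (u ('i *: v))%:C.
have ii : 'i * 'i = -1 :> R[i] by rewrite -expr2 sqr_i.
have uD v w : u (v + w) = u v + u w.
  by have := uL 1 v w; rewrite rmorph1 scale1r mul1r.
have u0 : u 0 = 0 by apply: (addrI (u 0)); rewrite -uD !addr0.
have uZ a v : u (a%:C *: v) = a * u v.
  by have := uL a v 0; rewrite u0 !addr0.
have hD v w : h (v + w) = h v + h w.
  by rewrite /h scalerDr !uD !rmorphD mulrDr opprD addrACA.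
have hZR a v : h (a%:C *: v) = a%:C * h v.
  have ia : 'i *: (a%:C *: v) = a%:C *: ('i *: v) by rewrite !scalerA mulrC.
  by rewrite /h ia !uZ !rmorphM mulrBr mulrCA.
have hZi v : h ('i *: v) = 'i * h v.
  rewrite /h scalerA ii mulrBr mulrA ii mulN1r opprK.
  have -> : u (-1 *: v) = - u v.
    by rewrite -[-1](rmorphN1 (real_complex R)) uZ mulN1r.
  by rewrite rmorphN mulrN opprK addrC.
exists h; last first.
  apply/negP => /eqP /(congr1 (@complex.Re R)).
  by rewrite /h ux /= mul0r mulr0 !subr0 => /eqP; rewrite oner_eq0.
split.
- move=> a v w; rewrite hD; congr (_ + _).
  rewrite (complexE a) scalerDl hD mulrDl hZR -scalerA hZi hZR.
  by rewrite mulrA.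
- have [k uk] := ub; exists (k + k) => v; rewrite mulrDl.
  rewrite (le_trans (ler_normB _ _))// lerD ?uk// normrM.
  have normi : `|'i : R[i]| = 1.
    by rewrite normc_def /= expr0n expr1n add0r sqrtr1.
  by rewrite normi mul1r (le_trans (uk _))// normrZ normi mul1r.
- by move=> v Mv; rewrite /h (uM _ (Mi _ Mv)) (uM _ Mv) rmorph0 mulr0 subr0.
Qed.

(** * Rank-one operators in Alg L *)

Section Operators.
Context {F : numFieldType} {X : normedModType F}.
Implicit Types S T : bounded_op X.

Lemma bounded_op_scaleAl c S T : (c *: S) * T = c *: (S * T).
Proof. exact: val_inj. Qed.

Lemma bounded_op_scaleAr c S T : S * (c *: T) = c *: (S * T).
Proof.
by apply/val_inj/funext => x; rewrite -[LHS]/(S (c *: T x)) linearZ.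
Qed.

Lemma bounded_op_add_self_eq0 T : T + T = 0 -> T = 0.
Proof.
move=> TT; have T2 : 2 *: T = 0 by rewrite scaler_nat mulr2n.
by rewrite -[T]scale1r -(@mulVf F 2) ?pnatr_eq0// -scalerA T2 scaler0.
Qed.
End Operators.

Section RankOne.
Context {F : numFieldType} {X : normedModType F} {L : subspace_lattice X}.

Lemma lattice_minusL E : L (lattice_minus L E).
Proof. by apply: lattice_sup => M []. Qed.

Lemma sub_lattice_minus E M : L M -> ~ E `<=` M -> M `<=` lattice_minus L E.
Proof.
move=> LM EM x Mx; apply: subset_closure => N [_ NU].
by apply: NU; exists M.
Qed.

Lemma Alg_invariant (A : Alg L) M x : L M -> M x -> M (A x).
Proof. by case: A => A /= /asboolP AL LM Mx; apply: (AL _ LM); exists x. Qed.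

(** A relation, because an element of [Alg L] also carries proofs of boundedness and invariance;
    [rank_one_exists] supplies the operator. *)
Definition rank_one E (e : X) (h : X -> F) (T : Alg L) :=
  [/\ E e, bounded_annihilator (lattice_minus L E) h &
      forall x, T x = h x *: e].

(** Each M in L either contains E, hence e, or lies in E_-, where h vanishes; it is invariant in
    both cases. *)
Lemma rank_one_exists E e h : E e ->
  bounded_annihilator (lattice_minus L E) h -> exists T, rank_one E e h T.
Proof.
move=> Ee hE; have [hlin [k hk] h0] := hE.
have Tb : (fun x => h x *: e) \in @bounded_linear F X.
  apply/asboolP; split=> [a x y|].
    by rewrite hlin scalerDl scalerA.
  exists (k * `|e|) => x; rewrite normrZ mulrAC.
  by rewrite ler_wpM2r.
have TL : BoundedOp Tb \in invariant_pred L.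
  apply/asboolP => M LM _ [x Mx <-] /=.
  have [M0 MD] := is_subspaceP (lattice_subspace LM).
  have [EM|EM] := pselect (E `<=` M).
    by rewrite -[_ *: _]addr0; apply: MD => //; exact: EM.
  by rewrite h0 ?scale0r//; exact: sub_lattice_minus LM EM _ Mx.
by exists (AlgOp TL).
Qed.

(** The functional h \o A still annihilates E_-, as E_- belongs to L and is invariant under A. *)
Lemma rank_oneMr E e h T (A : Alg L) : rank_one E e h T ->
  rank_one E e (h \o A) (T * A).
Proof.
move=> [Ee [hlin [k hk] h0] TE]; split=> // [|x]; last exact: (TE (A x)).
split.
- by move=> a v w /=; rewrite linearP hlin.
- have [l l0 Al] := bounded_op_bound A.
  have hk' v : `|h v| <= `|k| * `|v|.
    rewrite (le_trans (hk v))// -[leLHS]ger0_norm ?normrM ?normr_id//.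
    exact: le_trans (hk v).
  exists (`|k| * l) => v /=; rewrite (le_trans (hk' _))// -mulrA.
  exact: ler_wpM2l.
- move=> v Ev; apply: h0; apply: Alg_invariant Ev; exact: lattice_minusL.
Qed.

Lemma rank_oneMl E e h T (A : Alg L) : L E -> rank_one E e h T ->
  rank_one E (A e) h (A * T).
Proof.
move=> LE [Ee hE TE]; split=> //; first exact: Alg_invariant.
by move=> x; rewrite -linearZ -TE.
Qed.

Lemma rank_oneD E e h1 h2 T1 T2 : rank_one E e h1 T1 -> rank_one E e h2 T2 ->
  rank_one E e (fun x => h1 x + h2 x) (T1 + T2).
Proof.
move=> [Ee [l1 [k1 b1] z1] TE1] [_ [l2 [k2 b2] z2] TE2].
split=> // [|x]; last by rewrite scalerDl -TE1 -TE2.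
split.
- by move=> a v w; rewrite l1 l2 mulrDr addrACA.
- exists (k1 + k2) => v; rewrite mulrDl.
  by rewrite (le_trans (ler_normD _ _))// lerD.
- by move=> v Ev; rewrite z1// z2// addr0.
Qed.

Lemma rank_oneZ E e h c T : rank_one E e h T ->
  rank_one E e (fun x => c * h x) (c *: T).
Proof.
move=> [Ee [hlin [k hk] h0] TE]; split=> // [|x]; last by rewrite -scalerA -TE.
split.
- by move=> a v w; rewrite hlin mulrDr mulrCA.
- by exists (`|c| * k) => v; rewrite normrM -mulrA ler_wpM2l.
- by move=> v Ev; rewrite (h0 v Ev) mulr0.
Qed.

Lemma Alg_eq (S T : Alg L) : S =1 T -> S = T.
Proof. by move=> ST; apply/val_inj/val_inj/funext. Qed.

Hypothesis separate : forall (M : set X) x, is_subspace M -> ~ M x ->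
  exists2 h, bounded_annihilator M h & h x != 0.

Lemma Alg_valZ c (T : Alg L) : val (c *: T) = c *: val T.
Proof. exact: val_inj. Qed.

Lemma Alg_valM (S T : Alg L) : val (S * T) = val S * val T.
Proof. exact: val_inj. Qed.

Lemma Alg_valD (S T : Alg L) : val (S + T) = val S + val T.
Proof. exact: val_inj. Qed.

Lemma Alg_valB (S T : Alg L) : val (S - T) = val S - val T.
Proof. exact: val_inj. Qed.

(** Some y in E lies outside E_-; a functional separating it from E_- is normalized at y. *)
Lemma lattice_P_pairing E : lattice_P L E ->
  exists y g, [/\ E y, bounded_annihilator (lattice_minus L E) g & g y = 1].
Proof.
move=> [LE /existsNP[y /not_implyP[Ey nEy]]].
have [g [glin [k gk] g0] gy] :=
  separate (lattice_subspace (lattice_minusL E)) nEy.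
exists y, (fun x => (g y)^-1 * g x); split=> //; last by rewrite mulVf.
split.
- by move=> a v w; rewrite glin mulrDr mulrCA.
- by exists (`|(g y)^-1| * k) => v; rewrite normrM -mulrA ler_wpM2l.
- by move=> v Ev; rewrite (g0 v Ev) mulr0.
Qed.

(* When [h e = 0], the pairing [g y = 1] given by [E \in P_L] writes [e (x) h]
   as a combination of rank-one operators [e' (x) h'] with [h' e' != 0]. *)
Lemma rank_one_ind E (Q : Alg L -> Prop) : lattice_P L E ->
  (forall S T, Q S -> Q T -> Q (S + T)) -> (forall c T, Q T -> Q (c *: T)) ->
  (forall e h T, rank_one E e h T -> h e = 1 -> Q T) ->
  forall e h T, rank_one E e h T -> Q T.
Proof.
move=> PE QD QZ Q1 e h T T1.
have QB S U : Q S -> Q U -> Q (S - U).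
  by move=> QS QU; apply: QD => //; rewrite -scaleN1r; exact: QZ.
have [_ ED] := is_subspaceP (lattice_subspace PE.1).
have Qn0 e' h' T' : rank_one E e' h' T' -> h' e' != 0 -> Q T'.
  move=> T1' he; rewrite -[T']scale1r -(divff he) -scalerA; apply: QZ.
  by apply: (Q1 e' _ _ (rank_oneZ _ T1')); rewrite mulVf.
have [he|/Qn0] := eqVneq (h e) 0; last exact.
have [y [g [Ey gE gy]]] := lattice_P_pairing PE.
have [Ee hE TE] := T1.
have [S S1] := rank_one_exists Ey hE; have [_ _ SE] := S1.
have [U U1] := rank_one_exists Ee gE; have [_ _ UE] := U1.
have [W W1] := rank_one_exists Ey gE; have [_ _ WE] := W1.
have [hlin _ _] := hE; have [glin _ _] := gE.
have hD v w : h (v + w) = h v + h w.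
  by have := hlin 1 v w; rewrite scale1r mul1r.
have gD v w : g (v + w) = g v + g w.
  by have := glin 1 v w; rewrite scale1r mul1r.
have Eey : E (e + y) by rewrite -[e]scale1r; exact: ED.
(* Here e (x) h = (e + y) (x) h - y (x) h, and both pairings equal h(y). *)
have [hy|hy] := eqVneq (h y) 0; last first.
  have TS : rank_one E (e + y) h (T + S).
    by split=> // x; rewrite scalerDr -TE -SE.
  have -> : T = T + S - S by rewrite addrK.
  by apply: QB; [apply: Qn0 TS _; rewrite hD he add0r|exact: Qn0 S1 hy].
(* Here e (x) h = e (x) (h + g) - e (x) g, and both pairings equal g(e). *)
have [ge|ge] := eqVneq (g e) 0; last first.
  have TU := rank_oneD T1 U1.
  have -> : T = T + U - U by rewrite addrK.
  by apply: QB; [apply: Qn0 TU _; rewrite he add0r|exact: Qn0 U1 ge].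
(* Now h(e) = h(y) = g(e) = 0 and g(y) = 1. By polarization, e (x) h + y (x) g is half the sum of (e
   + y) (x) (h + g) and (e - y) (x) (h - g), whose pairings are both 1. *)
have TV : rank_one E (e + y) (fun x => h x + g x) ((T + S) + (U + W)).
  apply: rank_oneD; split=> // x; first by rewrite scalerDr -TE -SE.
  by rewrite scalerDr -UE -WE.
have eNy : E (e - y) by rewrite addrC -scaleN1r; exact: ED.
have TV' : rank_one E (e - y) (fun x => h x + -1 * g x)
    ((T - S) + -1 *: (U - W)).
  apply: rank_oneD; last apply: rank_oneZ; split=> // x.
    by rewrite scalerBr -TE -SE.
  by rewrite scalerBr -UE -WE.
have -> : T = 2^-1 *: ((T + S) + (U + W) + ((T - S) + -1 *: (U - W))) - W.
  apply: Alg_eq => x; rewrite -[RHS]/(2^-1 *: ((T x + S x) + (U x + W x) +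
    ((T x - S x) + -1 *: (U x - W x))) - W x).
  have -> : (T x + S x) + (U x + W x) + ((T x - S x) + -1 *: (U x - W x))
      = 2 *: (T x + W x).
    rewrite scaleN1r opprB scaler_nat mulr2n addrACA [T x + S x + _]addrACA.
    by rewrite subrr addr0 [U x + _]addrC [W x + U x + _]addrACA subrr
      addr0 addrACA.
  by rewrite scalerA mulVf ?pnatr_eq0// scale1r addrK.
have ey : e - y = -1 *: y + e by rewrite scaleN1r addrC.
apply: QB; last by apply: (Qn0 _ _ _ W1); rewrite gy oner_eq0.
apply/QZ/QD; [apply: Qn0 TV _|apply: Qn0 TV' _].
  by rewrite hD gD he ge hy gy !add0r oner_eq0.
rewrite ey hlin glin he ge hy gy.
by rewrite !(mulr0, mulr1, addr0, add0r, mulN1r, opprK) oner_eq0.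
Qed.

Hypothesis meet_minus :
  inf_subspace [set lattice_minus L E | E in lattice_P L] = [set 0].

(** If T x were outside E_-, some h annihilating E_- would have h(T x) != 0, and y (x) h would not
    kill T x for y != 0 in E. So T x lies in the meet of the E_-. *)
Lemma rank_one_mulI (T : bounded_op X) :
  (forall E e h S, lattice_P L E -> rank_one E e h S -> val S * T = 0) -> T = 0.
Proof.
move=> H; apply/val_inj/funext => x.
suff : inf_subspace [set lattice_minus L E | E in lattice_P L] (T x).
  by rewrite meet_minus.
move=> _ [E PE <-]; apply/not_notP => nE.
have [h hE hx] := separate (lattice_subspace (lattice_minusL E)) nE.
have [y [g [Ey [_ _ g0] gy]]] := lattice_P_pairing PE.
have [S S1] := rank_one_exists Ey hE; have [_ _ SE] := S1.
have : (val S * T) x = 0 by rewrite (H _ _ _ _ PE S1).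
have -> : (val S * T) x = h (T x) *: y by exact: SE.
move/eqP; rewrite scaler_eq0 (negPf hx) => /eqP y0.
have [m0 _] := is_subspaceP (lattice_subspace (lattice_minusL E)).
by move: gy; rewrite y0 (g0 0 m0) => /esym/eqP; rewrite oner_eq0.
Qed.

Lemma rank_one_idempotent E e h T : rank_one E e h T -> h e = 1 -> T * T = T.
Proof.
move=> [_ _ TE] he; apply: Alg_eq => x.
by rewrite -[LHS]/(T (T x)) (TE x) linearZ /= TE he scale1r.
Qed.

(** * The value of a WJD map at the identity *)

Section WJDOperators.
Variable delta : {linear Alg L -> bounded_op X}.
Hypothesis dW : WJD delta.

Let dW' (A B : Alg L) : A * B = 0 ->
  delta (A * B + B * A)
  = delta A * val B + val A * delta B + delta B * val A + val B * delta A.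
Proof. exact: dW. Qed.

(** For rank-one S, both S and S A commute with delta(I), hence S delta(I) A = delta(I) S A = S A
    delta(I). *)
Lemma WJD_unit_central (A : Alg L) : delta 1 * val A = val A * delta 1.
Proof.
have S_central E e h S : lattice_P L E -> rank_one E e h S ->
    delta 1 * val S = val S * delta 1.
  move=> PE.
  apply: (rank_one_ind (Q := fun S => delta 1 * val S = val S * delta 1))
    PE _ _ _ e h S => [S T SC TC|c T TC|e h T T1 he].
  - by rewrite raddfD mulrDr mulrDl SC TC.
  - by rewrite Alg_valZ bounded_op_scaleAr bounded_op_scaleAl TC.
  - exact: (wjd_unit_idempotent (@bounded_op_add_self_eq0 _ _) dW'
             (rank_one_idempotent T1 he)).
apply/eqP; rewrite -subr_eq0; apply/eqP/rank_one_mulI => E e h S PE S1.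
rewrite mulrBr !mulrA -(S_central _ _ _ _ PE S1) -[X in X - _]mulrA -!Alg_valM.
by rewrite (S_central _ _ _ _ PE (rank_oneMr A S1)) subrr.
Qed.

(** Applying the rank-one case to S and to S B gives delta(I) S A B = delta(I) A S B = delta(I) S B
    A. *)
Lemma WJD_unit_commutator (A B : Alg L) : delta 1 * val (A * B - B * A) = 0.
Proof.
have S_comm E e h S : lattice_P L E -> rank_one E e h S ->
    forall A, delta 1 * val (S * A) = delta 1 * val (A * S).
  move=> PE S1 C; apply/eqP; rewrite -subr_eq0 -mulrBr -Alg_valB; apply/eqP.
  apply: (rank_one_ind (Q := fun S => delta 1 * val (S * C - C * S) = 0))
    PE _ _ _ e h S S1 => [S T SC TC|c T TC|e h T T1 he].
  - have -> : (S + T) * C - C * (S + T) = (S * C - C * S) + (T * C - C * T).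
      by rewrite mulrDl mulrDr opprD addrACA.
    by rewrite raddfD mulrDr SC TC addr0.
  - have -> : c *: T * C - C * (c *: T) = c *: (T * C - C * T).
      apply: val_inj; rewrite Alg_valZ !(Alg_valB, Alg_valM) Alg_valZ.
      by rewrite bounded_op_scaleAr bounded_op_scaleAl scalerBr.
    by rewrite Alg_valZ bounded_op_scaleAr TC scaler0.
  - exact: (wjd_unit_commutator (@bounded_op_add_self_eq0 _ _) dW' C
             WJD_unit_central (rank_one_idempotent T1 he)).
apply: rank_one_mulI => E e h S PE S1.
rewrite mulrA -WJD_unit_central -mulrA -Alg_valM.
have -> : S * (A * B - B * A) = S * A * B - S * B * A.
  by rewrite mulrBr !mulrA.
rewrite Alg_valB mulrBr (Alg_valM (S * A)) (mulrA (delta 1)).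
rewrite (S_comm _ _ _ _ PE S1 A) -(mulrA (delta 1)) -Alg_valM -(mulrA A).
by rewrite -(S_comm _ _ _ _ PE (rank_oneMr B S1) A) subrr.
Qed.

End WJDOperators.

(** * WJD maps vanishing at the identity are derivations *)

Section UnitZero.
Variable d : {linear Alg L -> bounded_op X}.
Hypothesis dW : forall A B : Alg L, A * B = 0 ->
  d (A * B + B * A)
  = d A * val B + val A * d B + d B * val A + val B * d A.
Hypothesis d1 : d 1 = 0.

Let jordan (S A : Alg L) := d (S * A + A * S)
  = d S * val A + val S * d A + d A * val S + val A * d S.

(** This also reaches the square-zero rank-one operators, to which [sq0] below applies it. *)
Lemma WJD_jordan_rank_one E e h S A : lattice_P L E -> rank_one E e h S ->
  jordan S A.
Proof.
move=> PE S1.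
apply: (rank_one_ind (Q := fun S => jordan S A)) PE _ _ _ e h S S1
    => [S T JS JT|c T JT|e h T T1 he].
- move: JS JT; rewrite /jordan => JS JT.
  have -> : (S + T) * A + A * (S + T) = (S * A + A * S) + (T * A + A * T).
    by rewrite mulrDl mulrDr addrACA.
  have -> : val (S + T) = val S + val T by exact: val_inj.
  rewrite (linearD d S T) (linearD d (S * A + _)) JS JT !mulrDl !mulrDr.
  rewrite [LHS]addrACA; congr (_ + _); rewrite [LHS]addrACA; congr (_ + _).
  by rewrite [LHS]addrACA.
- rewrite /jordan.
  have -> : c *: T * A + A * (c *: T) = c *: (T * A + A * T).
    apply: val_inj; rewrite Alg_valZ !(Alg_valD, Alg_valM) Alg_valZ.
    by rewrite bounded_op_scaleAr bounded_op_scaleAl scalerDr.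
  rewrite !(linearZZ d) JT Alg_valZ.
  by rewrite !(bounded_op_scaleAr, bounded_op_scaleAl) !scalerDr.
- exact: (wjd_jordan_idempotent dW d1 A (rank_one_idempotent T1 he)).
Qed.

Lemma WJD_derivation_rank_one E e h S A : lattice_P L E -> rank_one E e h S ->
  d (S * A) = d S * val A + val S * d A.
Proof.
move=> PE S1.
apply: (rank_one_ind (Q := fun S => d (S * A) = d S * val A + val S * d A))
    (PE) _ _ _ e h S S1 => [S T JS JT|c T JT|e h T T1 he].
- have -> : (S + T) * A = S * A + T * A by rewrite mulrDl.
  have -> : val (S + T) = val S + val T by exact: val_inj.
  by rewrite (linearD d S T) (linearD d (S * A)) JS JT !mulrDl addrACA.
- have -> : c *: T * A = c *: (T * A) by apply: val_inj; exact: val_inj.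
  rewrite !(linearZZ d) JT Alg_valZ.
  by rewrite !bounded_op_scaleAl scalerDr.
have TT := rank_one_idempotent T1 he; have [Ee hE TE] := T1.
have sq0 e' h' N : rank_one E e' h' N -> N * N = 0 ->
    d N * val N + val N * d N = 0.
  move=> N1 NN; apply: bounded_op_add_self_eq0.
  have := WJD_jordan_rank_one N PE N1.
  by rewrite /jordan NN addr0 raddf0 addrA => <-.
have dT := wjd_idempotent (@bounded_op_add_self_eq0 _ _) dW d1 TT.
have dcT c : d (c *: T) = d T * val (c *: T) + val T * d (c *: T).
  rewrite !(linearZZ d) [in LHS]dT Alg_valZ.
  by rewrite bounded_op_scaleAr bounded_op_scaleAr scalerDr.
have mulE (S : Alg L) (U : bounded_op X) y : (val S * U) y = S (U y) by [].
have hT (S : bounded_op X) : (forall x, h (S x) = 0) -> val T * S = 0.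
  move=> hS; apply/val_inj/funext => x.
  by rewrite -[LHS]/(T (S x)) TE hS scale0r.
have eT (S : bounded_op X) : S e = 0 -> S * val T = 0.
  move=> Se; apply/val_inj/funext => x.
  by rewrite -[LHS]/(S (T x)) TE linearZ /= Se scaler0.
apply: (wjd_derivation_idempotent (@bounded_op_add_self_eq0 _ _) dW d1 TT).
(* A rank-one corner is one-dimensional, so only multiples of T have to be considered. *)
- have -> : T * A * T = h (A e) *: T; last exact: dcT.
  apply: Alg_eq => x; rewrite -[LHS]/(T (A (T x))) (TE x) !linearZ /= TE.
  by rewrite -[RHS]/(h (A e) *: T x) TE !scalerA mulrC.
- set N := T * A * (1 - T).
  have N1 : rank_one E e (h \o (A * (1 - T))) N.
    by rewrite /N -mulrA; exact: rank_oneMr.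
  have TN : T * N = N by rewrite /N !mulrA TT.
  have NT : N * T = 0 by rewrite /N -mulrA mulrBl mul1r TT subrr mulr0.
  have NN : N * N = 0 by rewrite -{2}TN mulrA NT mul0r.
  apply: eT; set n := h \o _ in N1; have [_ _ NE] := N1.
  have [n0|/existsNP[v /eqP nv]] := pselect (forall v, n v = 0).
    have -> : N = 0 by apply: Alg_eq => x; rewrite NE n0 scale0r.
    by rewrite raddf0 mulr0.
  (* Left multiplication by 1 - T kills N d(N), as T N = N. Since N v = n(v) e with n(v) != 0, it
     follows that (1 - T) d(N) vanishes at e. *)
  have UN : (1 - val T) * d N * val N = 0.
    have /eqP := sq0 _ _ _ N1 NN.
    rewrite addr_eq0 -mulrA => /eqP->.
    by rewrite mulrN mulrA mulrBl mul1r -Alg_valM TN subrr mul0r oppr0.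
  have /eqP : n v *: ((1 - val T) * d N) e = 0.
    by rewrite -linearZ /= -NE -[LHS]/(((1 - val T) * d N * val N) v) UN.
  by rewrite scaler_eq0 (negPf nv) => /eqP.
- set M := (1 - T) * A * T.
  have M1 : rank_one E (((1 - T) * A) e) h M by exact: rank_oneMl PE.1 T1.
  have MT : M * T = M by rewrite /M -mulrA TT.
  have TM : T * M = 0 by rewrite /M !mulrA mulrBr mulr1 TT subrr !mul0r.
  have MM : M * M = 0 by rewrite -{1}MT -mulrA TM mulr0.
  rewrite -mulrA; apply: hT => x; set u := ((1 - T) * A) e in M1.
  have [_ _ ME] := M1.
  have [u0|u0] := eqVneq u 0.
    have -> : M = 0 by apply: Alg_eq => y; rewrite ME u0 scaler0.
    have [_ _ h0] := hE; rewrite raddf0 mul0r; apply: h0.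
    by have [] := is_subspaceP (lattice_subspace (lattice_minusL E)).
  (* Dually, right multiplication by 1 - T kills d(M) M, as M T = M. Since M x = h(x) u with u != 0,
     it follows that h vanishes on the range of d(M) (1 - T). *)
  have MU : val M * (d M * (1 - val T)) = 0.
    have /eqP := sq0 _ _ _ M1 MM.
    rewrite (mulrA (val M) (d M)) addrC addr_eq0 => /eqP->.
    by rewrite mulNr -mulrA mulrBr mulr1 -Alg_valM MT subrr mulr0 oppr0.
  have /eqP : h ((d M * (1 - val T)) x) *: u = 0.
    by rewrite -ME -mulE MU.
  by rewrite scaler_eq0 (negPf u0) orbF => /eqP.
Qed.

(** As S A is again rank-one, d(S A B) expands both as d(S (A B)) and as d((S A) B); comparing the
    two leaves S times the derivation defect. *)
Lemma WJD_derivation : derivation d.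
Proof.
move=> A B; apply/eqP; rewrite -subr_eq0; apply/eqP.
apply: rank_one_mulI => E e h S PE S1.
have dS := WJD_derivation_rank_one.
have := dS _ _ _ _ (A * B) PE S1.
rewrite mulrA (dS _ _ _ _ B PE (rank_oneMr A S1)) (dS _ _ _ _ A PE S1).
rewrite !Alg_valM mulrDl -addrA !mulrA => /addrI H.
by rewrite mulrBr mulrDr !mulrA -H addrC subrr.
Qed.
End UnitZero.
End RankOne.

(** * The two directions of the equivalence and the theorem *)

Lemma generalized_derivation_WJD (F : numFieldType) (X : normedModType F)
    (L : subspace_lattice X) (delta : {linear Alg L -> bounded_op X}) :
  generalized_derivation delta ->
  (forall A : Alg L, commutant L (delta 1 * A)) -> WJD delta.
Proof.
move=> dG dC A B AB.
have d1C (C : Alg L) : delta 1 * C = (C : bounded_op X) * delta 1.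
  by have := dC 1 C; rewrite -[alg_op 1]/(1 : bounded_op X) mulr1.
have AB0 : (A : bounded_op X) * B = 0 by rewrite -[0]/(val (0 : Alg L)) -AB.
have z1 : (A : bounded_op X) * delta 1 * B = 0.
  by rewrite -(d1C A) -mulrA AB0 mulr0.
have z2 : (B : bounded_op X) * delta 1 * A = 0.
  (* B A need not vanish, but delta(I) B commutes with A, which brings back the product A B. *)
  by rewrite -(d1C B) (dC B A) (d1C B) mulrA AB0 mul0r.
by rewrite (linearD delta) !dG z1 z2 !subr0 addrA.
Qed.

Lemma WJD_generalized_derivation (F : numFieldType) (X : normedModType F)
    (L : subspace_lattice X) (delta : {linear Alg L -> bounded_op X}) :
  (forall (M : set X) x, is_subspace M -> ~ M x ->
     exists2 h, bounded_annihilator M h & h x != 0) ->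
  inf_subspace [set lattice_minus L E | E in lattice_P L] = [set 0] ->
  WJD delta -> generalized_derivation delta /\
    forall A : Alg L, commutant L (delta 1 * A).
Proof.
move=> separate meet0 dW.
have d1C := WJD_unit_central separate meet0 dW.
have d1AB (A B : Alg L) : delta 1 * val A * val B = delta 1 * val B * val A.
  apply/eqP; rewrite -subr_eq0 -!mulrA -!Alg_valM -mulrBr -Alg_valB.
  by rewrite (WJD_unit_commutator separate meet0 dW).
(* Subtracting left multiplication by delta(I) reduces to a map vanishing at the identity. *)
pose D : Alg L -> bounded_op X := fun A => delta A - delta 1 * val A.
have D_linear : linear D.
  move=> a A B; rewrite /D linearP Alg_valD Alg_valZ mulrDr bounded_op_scaleAr.
  by rewrite scalerBr opprD addrACA.
pose Dl : {linear Alg L -> bounded_op X} :=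
  HB.pack D (GRing.isLinear.Build F (Alg L) (bounded_op X) *:%R D D_linear).
have D1 : Dl 1 = 0 by rewrite -[LHS]/(delta 1 - delta 1 * 1) mulr1 subrr.
have DW : WJD Dl.
  move=> A B AB.
  have zAB : delta 1 * val A * val B = 0.
    by rewrite -mulrA -Alg_valM AB mulr0.
  (* This is where delta(I) killing commutators makes D inherit WJD: all correction terms then
     vanish. *)
  have zBA : delta 1 * val B * val A = 0 by rewrite -d1AB.
  have D0 (C : Alg L) : delta 1 * val C = 0 -> D C = delta C.
    by rewrite /D => ->; rewrite subr0.
  rewrite -[LHS]/(D (A * B + B * A)) D0; last first.
    by rewrite Alg_valD mulrDr !Alg_valM !mulrA zAB zBA addr0.
  rewrite dW// -[Dl A]/(delta A - delta 1 * val A).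
  rewrite -[Dl B]/(delta B - delta 1 * val B) !mulrBl !mulrBr !mulrA.
  by rewrite zAB zBA -!d1C zAB zBA !subr0.
have DD : derivation Dl := WJD_derivation separate meet0 DW D1.
split=> A B.
  have := DD A B; rewrite -[Dl _]/(delta (A * B) - delta 1 * val (A * B)).
  rewrite -[Dl A]/(delta A - delta 1 * val A).
  rewrite -[Dl B]/(delta B - delta 1 * val B).
  move/eqP; rewrite subr_eq => /eqP->; rewrite mulrBl mulrBr mulrA -d1C.
  by rewrite Alg_valM mulrA addrA subrK addrAC.
by rewrite d1AB mulrA -d1C.
Qed.

Theorem theorem3p3 (R : realType) (F : numFieldType)
    (F_real_or_complex : F = R :> numFieldType \/ F = R[i] :> numFieldType)
    (X : completeNormedModType F) (L : subspace_lattice X)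
    (meet_minus : inf_subspace [set lattice_minus L E | E in lattice_P L]
                  = [set 0])
    (delta : {linear Alg L -> bounded_op X}) :
  (WJD delta <->
     generalized_derivation delta /\
     forall A : Alg L, commutant L (delta 1 * A)) /\
  (delta 1 = 0 -> (WJD delta <-> derivation delta)).
Proof.
have char : WJD delta <-> generalized_derivation delta /\
    forall A : Alg L, commutant L (delta 1 * A).
  split=> [|[]]; [|exact: generalized_derivation_WJD].
  apply: WJD_generalized_derivation => // M x.
  exact: (separation F_real_or_complex).
split=> // d1.
have gd : generalized_derivation delta <-> derivation delta.
  by split=> dD A B; have := dD A B; rewrite d1 mulr0 mul0r subr0.
rewrite char gd; split=> [[]//|dD]; split=> // A B.
by rewrite d1 !(mul0r, mulr0).
Qed.
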